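(* Let $\Gamma$ be a gain operator on $\ell^\infty_+(\mathcal I)$. The following are equivalent: (a) there is $\rho\in\mathcal K_\infty$ such that $\Gamma_\rho$ satisfies the $\oplus$-MBI property; (b) there exist $\rho\in\mathcal K_\infty$ and a path $\sigma:\mathbb R_+\to\ell^\infty_+(\mathcal I)$ such that: $\sigma(r)\in\Psi(\Gamma_\rho)$ for all $r\ge0$; $\varphi_{\min}(r)\mathbf 1\le\sigma(r)\le\varphi_{\max}(r)\mathbf 1$ for all $r\ge0$ for some $\varphi_{\min},\varphi_{\max}\in\mathcal K_\infty$; $\sigma$ is increasing; (C1) $\sigma$ is norm-continuous from below, i.e. $\rho_n\to\rho_0$ from below implies $\|\sigma(\rho_n)-\sigma(\rho_0)\|\to0$; (C2) $\sigma$ is sequentially weak$^*$ continuous from above, i.e. $\rho_n\to\rho_0$ from above implies $\sigma(\rho_n)\to\sigma(\rho_0)$ weak$^*$.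
   Context: Let $\mathcal I$ be a nonempty countable index set; $\ell^\infty_+(\mathcal I)$ is the cone of nonnegative real families $s=(s_i)_{i\in\mathcal I}$ with $\|s\|:=\sup_i|s_i|<\infty$, ordered componentwise; $\mathbf 1$ is the all-ones vector; $\oplus$ is the componentwise maximum. A sequence in $\ell^\infty(\mathcal I)$ converges weak$^*$ (viewing $\ell^\infty=(\ell^1)^*$) iff it is norm-bounded and converges componentwise. $\mathcal K_\infty$: continuous strictly increasing unbounded $\gamma:\mathbb R_+\to\mathbb R_+$ with $\gamma(0)=0$, acting componentwise. For $\mathcal J\subset\mathcal I$, $s_{|\mathcal J}$ agrees with $s$ on $\mathcal J$ and is $0$ elsewhere. Gain operator: for each $i$ a finite (possibly empty) $\mathcal I_i\subset\mathcal I\setminus\{i\}$; directed graph $\mathcal G$ with vertices $\mathcal I$ and edges $ji$, $j\in\mathcal I_i$; a pointwise equicontinuous family $\gamma_{ij}\in\mathcal K_\infty$ ($ji\in E(\mathcal G)$); functions $\mu_i:\ell^\infty_+(\mathcal I)\to[0,\infty]$ with (M1) some $\xi\in\mathcal K_\infty$ has $\mu_i(0)=0$, $\mu_i(s)\ge\xi(\|s\|)$; (M2) $\mu_i$ monotone; (M3) for each finite $\mathcal J$, $\mu_i$ restricted to vectors vanishing off $\mathcal J$ is finite-valued and continuous; (M4) for each norm-bounded $A$ and $\varepsilon>0$ there is $\delta>0$ with $\sup_i|\mu_i(s_{|\mathcal I_i})-\mu_i(s^0_{|\mathcal I_i})|\le\varepsilon$ whenever $s^0\in A$, $\|s-s^0\|\le\delta$.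 $\Gamma_i(s):=\mu_i([\gamma_{ij}(s_j)]_{j\in\mathcal I_i})$ (argument zero outside $\mathcal I_i$). $\Gamma_\rho:=(\mathrm{id}+\rho)\circ\Gamma$. $\Psi(T):=\{s:T(s)\le s\}$. A monotone $T$ has the $\oplus$-MBI property if there is $\varphi\in\mathcal K_\infty$ such that for all $s,b$, $s\le b\oplus T(s)$ implies $\|s\|\le\varphi(\|b\|)$. *)

(* Defs.v *)
From Stdlib Require Import Reals List ClassicalEpsilon.
From Coquelicot Require Import Coquelicot.
Set Implicit Arguments.
Open Scope R_scope.

Section Defs.
Variable I : Type.

(** sup norm ||s|| := sup_i |s_i| (meaningful for bounded s) *)
Definition supnorm (s : I -> R) : R :=
  real (Lub_Rbar (fun x => exists i, x = Rabs (s i))).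

Definition bounded (s : I -> R) : Prop := exists M, forall i, Rabs (s i) <= M.

Definition linf_pos (s : I -> R) : Prop := (forall i, 0 <= s i) /\ bounded s.

Definition vle (s t : I -> R) : Prop := forall i, s i <= t i.

Definition vsub (s t : I -> R) : I -> R := fun i => s i - t i.

Definition vzero : I -> R := fun _ => 0.

Definition restr (J : list I) (s : I -> R) : I -> R :=
  fun j => if excluded_middle_informative (In j J) then s j else 0.

Definition supported_in (J : list I) (s : I -> R) : Prop :=
  forall j, ~ In j J -> s j = 0.

(** weak* convergence of sequences in l^oo = (l^1)^*: norm-bounded and componentwise *)
Definition weakstar_cv (u : nat -> I -> R) (l : I -> R) : Prop :=
  (exists M, forall n, supnorm (u n) <= M) /\ (forall i, Un_cv (fun n => u n i) (l i)).

Definition Psi (T : (I -> R) -> (I -> R)) (s : I -> R) : Prop :=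
  linf_pos s /\ vle (T s) s.
End Defs.

Definition Kinf (g : R -> R) : Prop :=
  g 0 = 0 /\
  (forall x, 0 <= x -> forall eps, 0 < eps -> exists delta, 0 < delta /\
      forall y, 0 <= y -> Rabs (y - x) < delta -> Rabs (g y - g x) < eps) /\
  (forall x y, 0 <= x -> x < y -> g x < g y) /\
  (forall M, exists x, 0 <= x /\ M < g x).

Section Gain.
Variable I : Type.

Definition oplus_MBI (T : (I -> R) -> (I -> R)) : Prop :=
  exists phi, Kinf phi /\
    forall s b, linf_pos s -> linf_pos b ->
      (forall i, s i <= Rmax (b i) (T s i)) -> supnorm s <= phi (supnorm b).

Definition Gamma (Iset : I -> list I) (gam : I -> I -> R -> R)
    (mu : I -> (I -> R) -> Rbar) (s : I -> R) : I -> R :=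
  fun i => real (mu i (fun j => if excluded_middle_informative (In j (Iset i))
                                then gam i j (s j) else 0)).

Definition Gamma_rho (rho : R -> R) (T : (I -> R) -> (I -> R)) (s : I -> R) : I -> R :=
  fun i => T s i + rho (T s i).

Definition gain_operator_data (Iset : I -> list I) (gam : I -> I -> R -> R)
    (mu : I -> (I -> R) -> Rbar) : Prop :=
  (forall i, ~ In i (Iset i)) /\
  (forall i j, In j (Iset i) -> Kinf (gam i j)) /\
  (forall r, 0 <= r -> forall eps, 0 < eps -> exists delta, 0 < delta /\
     forall i j, In j (Iset i) -> forall r', 0 <= r' -> Rabs (r' - r) < delta ->
       Rabs (gam i j r' - gam i j r) < eps) /\
  (exists xi, Kinf xi /\ forall i, mu i (@vzero I) = Finite 0 /\
     forall s, linf_pos s -> Rbar_le (Finite (xi (supnorm s))) (mu i s)) /\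
  (forall i s, linf_pos s -> Rbar_le (Finite 0) (mu i s)) /\
  (forall i s t, linf_pos s -> linf_pos t -> vle s t -> Rbar_le (mu i s) (mu i t)) /\
  (forall i (J : list I),
     (forall s, linf_pos s -> supported_in J s -> is_finite (mu i s)) /\
     (forall s, linf_pos s -> supported_in J s -> forall eps, 0 < eps ->
        exists delta, 0 < delta /\ forall t, linf_pos t -> supported_in J t ->
          supnorm (vsub t s) < delta -> Rabs (real (mu i t) - real (mu i s)) < eps)) /\
  (forall A : (I -> R) -> Prop, (forall s, A s -> linf_pos s) ->
     (exists M, forall s, A s -> supnorm s <= M) ->
     forall eps, 0 < eps -> exists delta, 0 < delta /\
       forall s s0, linf_pos s -> A s0 -> supnorm (vsub s s0) <= delta ->
         forall i, Rabs (real (mu i (restr (Iset i) s)) - real (mu i (restr (Iset i) s0))) <= eps).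
End Gain.

(* Main.v *)
(** (a) => (b): by the MBI property and monotonicity, [s |-> r 1 (+) Gamma_rho s] has a largest
    fixed point [M r], with [r <= M r <= phi r]. Applying this map for [r = e^k] repeatedly to
    [M (e^(k+1))] gives a sequence decreasing componentwise to [M (e^k)], and everything between
    two consecutive iterates lies in [Psi Gamma_rho]; so linear interpolation yields a path from
    [M (e^(k+1))] down to [M (e^k)], which is norm-continuous except at its lower end point.
    (b) => (a): with [rho / 2] in place of [rho], the path dominates every [s] with
    [s <= b (+) Gamma s] as soon as [phimin r >= ||b||]. *)
Require Import Defs.
From Stdlib Require Import Reals List Classical ClassicalEpsilon Lra Lia.
From Coquelicot Require Import Coquelicot.
Open Scope R_scope.

(** * Class K-infinity *)

(** The curve [r |-> M r] is itself increasing, lies in [Psi] and is weak* continuous from above: a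
    componentwise limit of [M r] as [r] decreases to [r0] is a fixed point for [r0] above [M r0],
    hence equal to it. From below the limit may be a smaller fixed point, so this curve can jump and
    violate (C1). This is why [M] is kept only at the points [e^k] and the gaps are bridged by
    iteration. Componentwise limits pass through the operator because entry [i] of [Gamma s] reads
    only the finitely many entries of [s] in [Iset i]. The grid [e^k], with [k] over all integers,
    accumulates at 0 and is unbounded, and its constant ratio costs only a factor [e] in the
    K-infinity bounds. In the converse direction, (C1) moves below [sigma r0] by an amount that is
    uniform over the entries; strict inequality in every entry would not be enough, and the slack
    between [rho / 2] and [rho] supplies the uniform margin. *)

Lemma Kinf_le (g : R -> R) (x y : R) : Kinf g -> 0 <= x -> x <= y -> g x <= g y.
Proof.
intros (_ & _ & Hs & _) Hx [Hxy | ->]; [left; now apply Hs | lra].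
Qed.

Lemma Kinf_ge0 (g : R -> R) (x : R) : Kinf g -> 0 <= x -> 0 <= g x.
Proof.
intros Hg Hx. pose proof (Kinf_le g 0 x Hg ltac:(lra) Hx) as H.
destruct Hg as (H0 & _). lra.
Qed.

Lemma Kinf_gt0 (g : R -> R) (x : R) : Kinf g -> 0 < x -> 0 < g x.
Proof.
intros (H0 & _ & Hs & _) Hx. rewrite <- H0. apply Hs; lra.
Qed.

Lemma Kinf_lt_inv (g : R -> R) (x y : R) : Kinf g -> 0 <= y -> g x < g y -> x < y.
Proof.
intros Hg Hy H. apply Rnot_le_lt; intros Hle.
pose proof (Kinf_le g y x Hg Hy Hle). lra.
Qed.

Lemma Kinf_scal (c : R) : 0 < c -> Kinf (fun x => c * x).
Proof.
intros Hc; repeat split.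
- ring.
- intros x Hx eps He. exists (eps / c). split; [now apply Rdiv_lt_0_compat|].
  intros y Hy H. replace (c * y - c * x) with (c * (y - x)) by ring.
  rewrite Rabs_mult, (Rabs_pos_eq c) by lra.
  apply (Rmult_lt_compat_l c) in H; [|lra].
  replace (c * (eps / c)) with eps in H by (field; lra). lra.
- intros x y Hx Hxy. now apply Rmult_lt_compat_l.
- intros M. exists ((Rabs M + 1) / c). pose proof (Rabs_pos M). split.
  + apply Rdiv_le_0_compat; lra.
  + replace (c * ((Rabs M + 1) / c)) with (Rabs M + 1) by (field; lra).
    pose proof (Rle_abs M). lra.
Qed.

Lemma Kinf_comp (f g : R -> R) : Kinf f -> Kinf g -> Kinf (fun x => f (g x)).
Proof.
intros Hf Hg. pose proof (fun x => Kinf_ge0 g x Hg) as Hg0.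
pose proof (fun x y => Kinf_le f x y Hf) as Hfle.
destruct Hf as (f0 & fc & fs & fu); destruct Hg as (g0 & gc & gs & gu).
repeat split.
- now rewrite g0.
- intros x Hx eps He.
  destruct (fc (g x) (Hg0 x Hx) eps He) as (d1 & Hd1 & H1).
  destruct (gc x Hx d1 Hd1) as (d2 & Hd2 & H2).
  exists d2; split; [easy|]. intros y Hy H. now apply H1; auto.
- intros x y Hx Hxy. apply fs; auto.
- intros M. destruct (fu M) as (y & Hy & HM). destruct (gu y) as (x & Hx & H).
  exists x; split; [easy|]. apply Rlt_le_trans with (1 := HM). apply Hfle; lra.
Qed.

Lemma Kinf_surj (g : R -> R) (y : R) : Kinf g -> 0 <= y -> exists x, 0 <= x /\ g x = y.
Proof.
intros (g0 & gc & gs & gu) Hy.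
destruct (gu y) as (z & Hz & Hgz).
(* [Kinf] says nothing about negative arguments, while the intermediate value theorem asks for
   continuity on the whole line; [Rabs] extends [g] evenly. *)
assert (Hc : continuity (fun x => g (Rabs x) - y)).
{ intros x eps He.
  destruct (gc (Rabs x) (Rabs_pos x) eps He) as (d & Hd & H).
  exists d; split; [easy|]. intros t [_ Ht].
  unfold dist, R_met, R_dist in *; simpl in *.
  replace (g (Rabs t) - y - (g (Rabs x) - y)) with (g (Rabs t) - g (Rabs x)) by ring.
  apply H; [apply Rabs_pos|].
  apply Rle_lt_trans with (2 := Ht). apply Rabs_triang_inv2. }
destruct (IVT_cor _ 0 z Hc Hz) as (x & Hx & E).
- rewrite Rabs_R0, g0, (Rabs_pos_eq z) by easy. nra.
- exists x; split; [easy|]. rewrite (Rabs_pos_eq x) in E by easy. lra.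
Qed.

Lemma Kinf_inverse (g : R -> R) :
  Kinf g -> exists h, Kinf h /\ forall y, 0 <= y -> 0 <= h y /\ g (h y) = y.
Proof.
intros Hg.
assert (Hex : forall y, exists x, 0 <= y -> 0 <= x /\ g x = y).
{ intros y. destruct (Rle_dec 0 y) as [Hy | Hy].
  - destruct (Kinf_surj g y Hg Hy) as (x & Hx). now exists x.
  - exists 0. intros; contradiction. }
destruct (choice _ Hex) as (h & Hh).
assert (Hlt : forall x y, 0 <= x -> x < y -> h x < h y).
{ intros x y Hx Hxy. destruct (Hh x Hx) as (_ & E).
  destruct (Hh y ltac:(lra)) as (Hy & E').
  apply (Kinf_lt_inv g); [easy..|]. lra. }
pose proof Hg as (g0 & gc & gs & gu).
exists h; split; [|easy]. repeat split.
- destruct (Hh 0 ltac:(lra)) as ([H | H] & E); [|easy].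
  apply (Kinf_gt0 g) in H; [lra|easy].
- intros y Hy eps He. destruct (Hh y Hy) as (Hx & E).
  assert (Hup : y < g (h y + eps)) by (rewrite <- E at 1; apply gs; lra).
  assert (Hlow : exists d, 0 < d /\ forall z, 0 <= z -> y - d < z -> h y - eps < h z).
  (* The natural lower bound [g (h y - eps / 2)] makes sense only for a nonnegative argument;
     otherwise [h y - eps] is negative and any [h z] exceeds it. *)
  { destruct (Rle_dec (h y) (eps / 2)) as [H | H].
    - exists 1. split; [lra|]. intros z Hz _. destruct (Hh z Hz). lra.
    - apply Rnot_le_lt in H.
      assert (Hd : g (h y - eps / 2) < y) by (rewrite <- E at 2; apply gs; lra).
      exists (y - g (h y - eps / 2)). split; [lra|]. intros z Hz Hyz.
      destruct (Hh z Hz) as (Hz0 & Ez).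
      assert (h y - eps / 2 < h z) by (apply (Kinf_lt_inv g); auto; lra). lra. }
  destruct Hlow as (d & Hd & Hlow).
  exists (Rmin d (g (h y + eps) - y)). split; [apply Rmin_glb_lt; lra|].
  intros z Hz Habs. apply Rabs_def2 in Habs.
  pose proof (Rmin_l d (g (h y + eps) - y)); pose proof (Rmin_r d (g (h y + eps) - y)).
  destruct (Hh z Hz) as (Hz0 & Ez).
  assert (h z < h y + eps) by (apply (Kinf_lt_inv g); auto; lra).
  pose proof (Hlow z Hz ltac:(lra)). apply Rabs_def1; lra.
- easy.
- intros M. pose proof (Rabs_pos M) as HM. pose proof (Rle_abs M).
  exists (g (Rabs M + 1)). split; [apply Kinf_ge0; auto; lra|].
  destruct (Hh (g (Rabs M + 1))) as (H1 & H2); [apply Kinf_ge0; auto; lra|].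
  assert (Rabs M < h (g (Rabs M + 1))); [|lra].
  apply (Kinf_lt_inv g); auto. rewrite H2. apply gs; lra.
Qed.

(** * The supremum norm *)

(** [supnorm] is the [real] part of an extended supremum, which is 0 by convention at infinite
    values. Boundedness excludes [p_infty], and an index excludes [m_infty]. *)
Lemma supnorm_is_lub (I : Type) (s : I -> R) :
  inhabited I -> Defs.bounded s -> is_lub (fun x => exists i, x = Rabs (s i)) (supnorm s).
Proof.
intros [i0] [M HM]. unfold supnorm.
pose proof (Lub_Rbar_correct (fun x => exists i, x = Rabs (s i))) as [Hub Hl].
destruct (Lub_Rbar _) as [l | |]; simpl.
- split.
  + intros x Hx. apply (Hub x Hx).
  + intros b Hb. apply (Hl (Finite b)). intros x Hx. now apply Hb.
- exfalso. apply (Hl (Finite M)). intros x (i & ->). apply HM.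
- exfalso. apply (Hub (Rabs (s i0))). now exists i0.
Qed.

Lemma Rabs_le_supnorm (I : Type) (s : I -> R) (i : I) : Defs.bounded s -> Rabs (s i) <= supnorm s.
Proof.
intros Hb. apply (supnorm_is_lub I s (inhabits i) Hb). now exists i.
Qed.

Lemma supnorm_le (I : Type) (s : I -> R) (M : R) :
  inhabited I -> (forall i, Rabs (s i) <= M) -> supnorm s <= M.
Proof.
intros Hi HM. apply (supnorm_is_lub I s Hi (ex_intro _ M HM)).
intros x (i & ->). apply HM.
Qed.

Lemma supnorm_ge0 (I : Type) (s : I -> R) : inhabited I -> Defs.bounded s -> 0 <= supnorm s.
Proof.
intros [i] Hb. apply Rle_trans with (2 := Rabs_le_supnorm I s i Hb). apply Rabs_pos.
Qed.

Lemma le_supnorm (I : Type) (s : I -> R) (i : I) : Defs.bounded s -> s i <= supnorm s.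
Proof.
intros Hb. apply Rle_trans with (2 := Rabs_le_supnorm I s i Hb). apply Rle_abs.
Qed.

Lemma linf_pos_le (I : Type) (s t : I -> R) :
  linf_pos t -> (forall i, 0 <= s i <= t i) -> linf_pos s.
Proof.
intros (_ & M & HM) H. split; [apply H|]. exists M. intros i.
destruct (H i). rewrite Rabs_pos_eq by easy.
apply Rle_trans with (2 := HM i). apply Rle_trans with (1 := H1). apply Rle_abs.
Qed.

Lemma linf_pos_between (I : Type) (s : I -> R) (M : R) :
  (forall i, 0 <= s i <= M) -> linf_pos s.
Proof.
intros H. split; [apply H|]. exists M. intros i. rewrite Rabs_pos_eq; apply H.
Qed.

(** * From a path to the MBI property *)

Definition nonneg_op {I : Type} (T : (I -> R) -> I -> R) : Prop :=
  forall s i, linf_pos s -> 0 <= T s i.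

Definition monotone_op {I : Type} (T : (I -> R) -> I -> R) : Prop :=
  forall s t, linf_pos s -> linf_pos t -> vle s t -> vle (T s) (T t).

(** For [x] at least a threshold [c], halving [rho] gains [rho c / 2]. Below the threshold both [x]
    and [rho x] are at most [m / 4], so the left side stays under [m / 2] whereas [y] is at least
    [m]. *)
Lemma half_rho_gap (rho : R -> R) (m : R) : Kinf rho -> 0 < m ->
  exists d, 0 < d /\ forall x y, 0 <= x -> m <= y -> x + rho x <= y -> x + / 2 * rho x <= y - d.
Proof.
intros Hr Hm. pose proof Hr as (r0 & rc & _).
destruct (rc 0 ltac:(lra) (m / 4) ltac:(lra)) as (d & Hd & Hc).
set (c := Rmin (d / 2) (m / 4)).
assert (Hc0 : 0 < c) by (apply Rmin_glb_lt; lra).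
assert (Hcd : c <= d / 2) by apply Rmin_l.
assert (Hcm : c <= m / 4) by apply Rmin_r.
pose proof (Kinf_gt0 rho c Hr Hc0).
exists (Rmin (m / 2) (rho c / 2)). split; [apply Rmin_glb_lt; lra|].
intros x y Hx Hy Hxy.
pose proof (Rmin_l (m / 2) (rho c / 2)); pose proof (Rmin_r (m / 2) (rho c / 2)).
destruct (Rle_dec c x) as [H' | H'].
- pose proof (Kinf_le rho c x Hr ltac:(lra) H'). lra.
- assert (Hx' : rho x < m / 4).
  { specialize (Hc x Hx). rewrite r0, !Rminus_0_r in Hc.
    rewrite (Rabs_pos_eq x) in Hc by lra. specialize (Hc ltac:(lra)).
    apply Rabs_def2 in Hc. lra. }
  lra.
Qed.

(* If [phimin (inf {r | s <= sigma r})] exceeded [b], then the gap between [rho / 2] and [rho]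
   would push [s] strictly and uniformly below [sigma] at the infimum, hence, by continuity from
   below, under [sigma r] for some smaller [r]. *)
Lemma path_MBI (I : Type) (T : (I -> R) -> I -> R) (rho : R -> R) (sigma : R -> I -> R)
    (phimin phimax : R -> R) :
  inhabited I ->
  nonneg_op T -> monotone_op T -> Kinf rho -> Kinf phimin -> Kinf phimax ->
  (forall r, 0 <= r -> Psi (Gamma_rho rho T) (sigma r)) ->
  (forall r, 0 <= r -> forall i, phimin r <= sigma r i <= phimax r) ->
  (forall (rn : nat -> R) r0, 0 <= r0 -> (forall n, 0 <= rn n <= r0) -> Un_cv rn r0 ->
        Un_cv (fun n => supnorm (vsub (sigma (rn n)) (sigma r0))) 0) ->
  (forall (rn : nat -> R) r0, 0 <= r0 -> (forall n, r0 <= rn n) -> Un_cv rn r0 ->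
        weakstar_cv (fun n => sigma (rn n)) (sigma r0)) ->
  oplus_MBI (Gamma_rho (fun x => / 2 * rho x) T).
Proof.
intros HI Tpos Tmono Hrho Hmin Hmax HPsi Hbd C1 C2.
destruct (Kinf_inverse phimin Hmin) as (h & Hh & Hinv).
(* With [h] the inverse of [phimin], a parameter with [phimin r0 <= supnorm b] is at most
   [h (supnorm b)], and [s <= sigma r0 <= phimax r0] then gives the bound. *)
exists (fun y => phimax (h y)). split; [now apply Kinf_comp|].
intros s b Hs Hb Hle.
pose proof (supnorm_ge0 I b HI (proj2 Hb)) as Hb0.
pose proof (supnorm_ge0 I s HI (proj2 Hs)) as Hs0.
(* [completeness] yields suprema, so the infimum of the parameters is taken through their
   negatives. *)
set (E := fun x => 0 <= - x /\ vle s (sigma (- x))).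
destruct (completeness E) as (m & Hub & Hlub).
- exists 0. intros x (Hx & _). lra.
- exists (- h (supnorm s)). destruct (Hinv _ Hs0) as (H1 & H2).
  split; rewrite Ropp_involutive; [easy|]. intros i.
  apply Rle_trans with (1 := le_supnorm I s i (proj2 Hs)).
  rewrite <- H2 at 1. apply Hbd, H1.
- set (r0 := - m).
  assert (Hr0 : 0 <= r0).
  { assert (m <= 0) by (apply Hlub; intros x (Hx & _); lra). unfold r0; lra. }
  assert (Hlow : forall r, 0 <= r -> vle s (sigma r) -> r0 <= r).
  { intros r Hr H. assert (- r <= m); [|unfold r0; lra].
    apply Hub. split; rewrite Ropp_involutive; auto. }
  assert (Happ : forall n, exists r, r0 <= r /\ r < r0 + / INR (S n) /\ vle s (sigma r)).
  { intros n. apply NNPP; intros Hn.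
    pose proof (RinvN_pos n) as Hp. rewrite <- S_INR in Hp.
    assert (m <= m - / INR (S n)); [|lra].
    apply Hlub. intros x Hx. apply Rnot_lt_le; intros Hlt. apply Hn.
    exists (- x). destruct Hx as (Hx1 & Hx2). split; [now apply Hlow|].
    split; [unfold r0; lra|easy]. }
  destruct (choice _ Happ) as (rn & Hrn).
  assert (Hcv : Un_cv rn r0).
  { intros eps He. destruct (archimed_cor1 eps He) as (N & HN & HN0).
    exists N. intros n Hn. destruct (Hrn n) as (H1 & H2 & _).
    unfold R_dist. rewrite Rabs_pos_eq by lra.
    assert (/ INR (S n) <= / INR N); [|lra].
    apply Rinv_le_contravar; [now apply lt_0_INR|]. apply le_INR; lia. }
  (* The infimum is attained: (C2) along [rn] preserves the inequality in each entry. *)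
  assert (Hsr0 : vle s (sigma r0)).
  { intros i. destruct (C2 rn r0 Hr0 (fun n => proj1 (Hrn n)) Hcv) as (_ & Hci).
    apply Rnot_lt_le; intros Hlt.
    destruct (Hci i (s i - sigma r0 i) ltac:(lra)) as (N & HN).
    specialize (HN N (Nat.le_refl _)). apply Rabs_def2 in HN.
    pose proof (proj2 (proj2 (Hrn N)) i). lra. }
  destruct (Rle_dec (phimin r0) (supnorm b)) as [Hc | Hc].
  + apply supnorm_le; [easy|]. intros i.
    rewrite Rabs_pos_eq by apply Hs.
    apply Rle_trans with (1 := Hsr0 i).
    apply Rle_trans with (1 := proj2 (Hbd r0 Hr0 i)).
    apply Kinf_le; [easy..|]. destruct (Hinv _ Hb0) as (H1 & H2).
    apply Rnot_lt_le; intros Hlt. destruct Hmin as (_ & _ & Hmin & _).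
    specialize (Hmin _ _ H1 Hlt). lra.
  + exfalso. apply Rnot_le_lt in Hc.
    assert (Hr0' : 0 < r0).
    { destruct Hr0 as [H | H]; [easy|]. rewrite <- H in Hc.
      rewrite (proj1 Hmin) in Hc. lra. }
    destruct (half_rho_gap rho (phimin r0) Hrho ltac:(lra)) as (d & Hd & Hgap).
    (* One margin for both arguments of the maximum: [d] serves the operator part, the other term
       the part coming from [b]. *)
    set (d' := Rmin d (phimin r0 - supnorm b)).
    assert (Hd' : 0 < d') by (apply Rmin_glb_lt; lra).
    assert (Hgap' : forall i, s i <= sigma r0 i - d').
    { intros i. apply Rle_trans with (1 := Hle i). apply Rmax_lub.
      - pose proof (le_supnorm I b i (proj2 Hb)). pose proof (Hbd r0 Hr0 i).
        pose proof (Rmin_r d (phimin r0 - supnorm b)). fold d' in H1. lra.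
      - destruct (HPsi r0 Hr0) as (Hl & HP). specialize (HP i).
        unfold Gamma_rho in *.
        pose proof (Tmono s (sigma r0) Hs Hl Hsr0 i) as Hm.
        pose proof (Tpos s i Hs) as Hp.
        pose proof (Kinf_le rho _ _ Hrho Hp Hm).
        pose proof (Hgap (T (sigma r0) i) (sigma r0 i) ltac:(lra) (proj1 (Hbd r0 Hr0 i)) HP).
        pose proof (Rmin_l d (phimin r0 - supnorm b)). fold d' in H1. lra. }
    set (qn := fun n => r0 * (1 - / INR (S n))).
    assert (Hinvn : forall n, 0 < / INR (S n) <= 1).
    { intros n. pose proof (RinvN_pos n) as Hp. rewrite <- S_INR in Hp. split; [easy|].
      rewrite <- Rinv_1. apply Rinv_le_contravar; [lra|]. rewrite S_INR.
      pose proof (pos_INR n). lra. }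
    assert (Hqn : forall n, 0 <= qn n <= r0).
    { intros n. unfold qn. specialize (Hinvn n). nra. }
    assert (Hqcv : Un_cv qn r0).
    { intros eps He.
      destruct (archimed_cor1 (eps / r0)) as (N & HN & HN0); [now apply Rdiv_lt_0_compat|].
      exists N. intros n Hn. unfold R_dist, qn.
      replace (r0 * (1 - / INR (S n)) - r0) with (- (r0 * / INR (S n))) by ring.
      rewrite Rabs_Ropp, Rabs_pos_eq by (specialize (Hinvn n); nra).
      assert (/ INR (S n) <= / INR N).
      { apply Rinv_le_contravar; [now apply lt_0_INR|]. apply le_INR; lia. }
      replace eps with (r0 * (eps / r0)) by (field; lra).
      apply Rmult_lt_compat_l; lra. }
    destruct (C1 qn r0 Hr0 Hqn Hqcv d' Hd') as (N & HN).
    specialize (HN N (Nat.le_refl _)).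
    assert (Hlt : qn N < r0) by (unfold qn; specialize (Hinvn N); nra).
    apply (Rlt_not_le _ _ Hlt). apply Hlow; [apply Hqn|]. intros i.
    assert (Hbb : Defs.bounded (vsub (sigma (qn N)) (sigma r0))).
    { exists (phimax (qn N) + phimax r0). intros j. unfold vsub.
      pose proof (Hbd _ (proj1 (Hqn N)) j). pose proof (Hbd _ Hr0 j).
      pose proof (Kinf_ge0 phimin _ Hmin (proj1 (Hqn N))).
      pose proof (Kinf_ge0 phimin _ Hmin Hr0).
      apply Rabs_le. lra. }
    unfold R_dist in HN. rewrite Rminus_0_r in HN. apply Rabs_def2 in HN.
    pose proof (Rabs_le_supnorm I _ i Hbb) as Hn. unfold vsub at 1 in Hn.
    specialize (Hgap' i).
    assert (Ha : Rabs (sigma (qn N) i - sigma r0 i) < d') by lra.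
    apply Rabs_def2 in Ha. lra.
Qed.

(** * Largest fixed points *)

(** Continuity of each entry for the product topology on the cone. This is more than norm-continuity
    of each entry, and it is what the passage to componentwise limits needs. *)
Definition pointwise_continuous_op {I : Type} (T : (I -> R) -> I -> R) : Prop :=
  forall i s, linf_pos s -> forall eps, 0 < eps -> exists delta (J : list I), 0 < delta /\
    forall t, linf_pos t -> (forall j, In j J -> Rabs (t j - s j) < delta) ->
      Rabs (T t i - T s i) < eps.

Definition join_const {I : Type} (T : (I -> R) -> I -> R) (r : R) (s : I -> R) : I -> R :=
  fun i => Rmax r (T s i).

(** Maximality is among all [s] below their image, not only among fixed points. Comparing two such
    [m], or a limit with [m], then takes a single inequality. *)
Definition largest_fixed_point {I : Type} (F : (I -> R) -> I -> R) (m : I -> R) : Prop :=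
  linf_pos m /\ (forall i, m i = F m i) /\ forall s, linf_pos s -> vle s (F s) -> vle s m.

Lemma join_const_mono (I : Type) (T : (I -> R) -> I -> R) (r r' : R) (s t : I -> R) :
  monotone_op T -> linf_pos s -> linf_pos t -> r <= r' -> vle s t ->
  vle (join_const T r s) (join_const T r' t).
Proof.
intros HT Hs Ht Hr Hst i. apply Rmax_lub.
- apply Rle_trans with (1 := Hr). apply Rmax_l.
- apply Rle_trans with (1 := HT s t Hs Ht Hst i). apply Rmax_r.
Qed.

Lemma sub_fixed_point_bound (I : Type) (T : (I -> R) -> I -> R) (phi : R -> R) (r : R)
    (s : I -> R) (i : I) :
  Kinf phi ->
  (forall s b, linf_pos s -> linf_pos b ->
      (forall i, s i <= Rmax (b i) (T s i)) -> supnorm s <= phi (supnorm b)) ->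
  0 <= r -> linf_pos s -> vle s (join_const T r s) -> s i <= phi r.
Proof.
intros Hphi HMBI Hr Hs Hle.
assert (Hc : linf_pos (fun _ : I => r)) by (apply linf_pos_between with r; intros; lra).
apply Rle_trans with (1 := le_supnorm I s i (proj2 Hs)).
apply Rle_trans with (1 := HMBI s (fun _ => r) Hs Hc Hle).
apply Kinf_le; [easy|apply supnorm_ge0; [easy|apply Hc]|].
apply supnorm_le; [easy|]. intros _. rewrite Rabs_pos_eq; lra.
Qed.

(** The Knaster-Tarski construction, on a cone that is not a complete lattice: the entrywise
    supremum of all vectors below their image exists and is bounded because the MBI property bounds
    them all by [phi r]. *)
Lemma largest_fixed_point_exists (I : Type) (T : (I -> R) -> I -> R) (phi : R -> R) (r : R) :
  nonneg_op T -> monotone_op T -> Kinf phi ->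
  (forall s b, linf_pos s -> linf_pos b ->
      (forall i, s i <= Rmax (b i) (T s i)) -> supnorm s <= phi (supnorm b)) ->
  0 <= r -> exists m, largest_fixed_point (join_const T r) m.
Proof.
intros Tpos Tmono Hphi HMBI Hr.
pose proof (fun s i => sub_fixed_point_bound I T phi r s i Hphi HMBI Hr) as Hbd.
set (E := fun i x => exists s, linf_pos s /\ vle s (join_const T r s) /\ x = s i).
assert (H0 : forall i, E i 0).
{ intros i. exists (fun _ => 0). split; [|split; [|easy]].
  - apply linf_pos_between with 0; intros; lra.
  - intros j. apply Rle_trans with (1 := Hr). apply Rmax_l. }
assert (Hlub : forall i, exists l, is_lub (E i) l).
{ intros i. destruct (completeness (E i)) as (l & Hl); [|now exists 0|now exists l].
  exists (phi r). intros x (s & Hs1 & Hs2 & ->). auto. }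
destruct (choice _ Hlub) as (m & Hm).
assert (Hmax : forall s, linf_pos s -> vle s (join_const T r s) -> vle s m).
{ intros s Hs Hle i. apply (Hm i). now exists s. }
assert (Hml : linf_pos m).
{ apply linf_pos_between with (phi r). intros i. split.
  - now apply (Hm i).
  - apply (Hm i). intros x (s & Hs1 & Hs2 & ->). auto. }
assert (Hsub : vle m (join_const T r m)).
{ intros i. apply (Hm i). intros x (s & Hs1 & Hs2 & ->).
  apply Rle_trans with (1 := Hs2 i). apply join_const_mono; auto; lra. }
exists m. repeat split; [apply Hml|apply Hml| |easy].
intros i. apply Rle_antisym; [apply Hsub|].
(* [F m] itself could be unbounded, so compare with [m] raised in the single entry [i]. *)
set (s := fun j => if excluded_middle_informative (j = i) then join_const T r m i else m j).
assert (Hms : vle m s).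
{ intros j. unfold s. destruct excluded_middle_informative as [-> | _]; [apply Hsub|lra]. }
assert (Hs : linf_pos s).
{ destruct Hml as (Hp & B & HB).
  apply linf_pos_between with (Rmax B (join_const T r m i)). intros j. split.
  - apply Rle_trans with (2 := Hms j). apply Hp.
  - unfold s. destruct excluded_middle_informative; [apply Rmax_r|].
    apply Rle_trans with (2 := Rmax_l _ _). apply Rle_trans with (2 := HB j). apply Rle_abs. }
assert (Hss : vle s (join_const T r s)).
{ intros j. apply Rle_trans with (join_const T r m j).
  - unfold s. destruct excluded_middle_informative as [-> | _]; [lra|apply Hsub].
  - apply join_const_mono; auto; lra. }
specialize (Hmax s Hs Hss i). unfold s in Hmax.
destruct excluded_middle_informative; [easy|contradiction].
Qed.

Lemma Un_cv_finite_uniform (I : Type) (u : nat -> I -> R) (l : I -> R) (J : list I) (eps : R) :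
  0 < eps -> (forall j, Un_cv (fun n => u n j) (l j)) ->
  exists N, forall n, (N <= n)%nat -> forall j, In j J -> Rabs (u n j - l j) < eps.
Proof.
intros He Hu. induction J as [|a J (N & HN)].
- exists O. now intros.
- destruct (Hu a eps He) as (N' & HN'). exists (Nat.max N N'). intros n Hn j [<- | Hj].
  + apply HN'. lia.
  + apply HN; [lia|easy].
Qed.

(** The iterates decrease and stay above [m], so they have an entrywise limit [l >= m]. From
    [l <= F (u n)] for all [n], pointwise continuity gives [l <= F l], and maximality of [m] gives
    [l <= m]. *)
Lemma iter_cv_largest_fixed_point (I : Type) (F : (I -> R) -> I -> R) (m s : I -> R) :
  nonneg_op F -> monotone_op F -> pointwise_continuous_op F -> largest_fixed_point F m ->
  linf_pos s -> vle (F s) s -> vle m s ->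
  forall i, Un_cv (fun n => Nat.iter n F s i) (m i).
Proof.
intros Fpos Fmono Fcont (Hml & Hm & Hmax) Hs HFs Hms.
set (u := fun n => Nat.iter n F s).
assert (Hu : forall n, linf_pos (u n) /\ vle m (u n) /\ vle (u (S n)) (u n)).
{ induction n as [|n (H1 & H2 & H3)]; [easy|].
  assert (Hl : linf_pos (u (S n))).
  { apply linf_pos_le with (u n); [easy|]. intros i. split; [apply Fpos, H1|apply H3]. }
  split; [easy|]. split.
  - intros i. rewrite Hm. apply Fmono; easy.
  - apply (Fmono (u (S n)) (u n)); easy. }
assert (Hcv : forall i, exists l, Un_cv (fun n => u n i) l).
{ intros i. destruct (decreasing_cv (fun n => u n i)) as (l & Hl); [| |now exists l].
  - intros n. apply Hu.
  - exists 0. intros x (n & ->). unfold opp_seq.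
    pose proof (proj1 (proj1 (Hu n)) i). lra. }
destruct (choice _ Hcv) as (l & Hl).
assert (Hlu : forall n, vle l (u n)).
{ intros n i. apply (decreasing_ineq (fun n => u n i)); [|easy]. intros k. apply Hu. }
assert (Hml' : vle m l).
{ intros i. apply Rnot_lt_le; intros Hlt.
  destruct (Hl i (m i - l i) ltac:(lra)) as (N & HN).
  specialize (HN N (Nat.le_refl _)). apply Rabs_def2 in HN.
  pose proof (proj1 (proj2 (Hu N)) i). lra. }
assert (Hll : linf_pos l).
{ apply linf_pos_le with s; [easy|]. intros i. split; [|apply (Hlu O)].
  apply Rle_trans with (2 := Hml' i). apply Hml. }
assert (Hlm : vle l m).
{ apply Hmax; [easy|]. intros i. apply Rnot_lt_le; intros Hlt.
  destruct (Fcont i l Hll (l i - F l i) ltac:(lra)) as (d & J & Hd & HJ).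
  destruct (Un_cv_finite_uniform I u l J d Hd Hl) as (N & HN).
  specialize (HJ (u N) (proj1 (Hu N)) (HN N (Nat.le_refl _))).
  apply Rabs_def2 in HJ. pose proof (Hlu (S N) i) as H. simpl in H.
  change (Nat.iter N F s) with (u N) in H. lra. }
intros i. replace (m i) with (l i); [apply Hl|].
apply Rle_antisym; [apply Hlm|apply Hml'].
Qed.

Lemma join_const_continuous (I : Type) (T : (I -> R) -> I -> R) (r : R) :
  pointwise_continuous_op T -> pointwise_continuous_op (join_const T r).
Proof.
intros HT i s Hs eps He. destruct (HT i s Hs eps He) as (d & J & Hd & H).
exists d, J. split; [easy|]. intros t Ht HtJ. specialize (H t Ht HtJ).
apply Rabs_def2 in H. unfold join_const, Rmax. apply Rabs_def1;
  destruct (Rle_dec r (T t i)); destruct (Rle_dec r (T s i)); lra.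
Qed.

(** * The path *)

Lemma exp_le_compat (x y : R) : x <= y -> exp x <= exp y.
Proof. intros [H | ->]; [left; now apply exp_increasing|lra]. Qed.

(** Break points in the variable [ln r]: they start at [k + 1] and decrease to [k] without reaching
    it, leaving room for infinitely many iterates in one unit interval. *)
Definition node (k : Z) (n : nat) : R := IZR k + / INR (S n).

Definition cell (k : Z) (n : nat) (x : R) : Prop := node k (S n) <= x <= node k n.

Lemma node_decr (k : Z) (n : nat) : node k (S n) < node k n.
Proof.
unfold node. apply Rplus_lt_compat_l, Rinv_lt_contravar; [|apply lt_INR; lia].
apply Rmult_lt_0_compat; apply lt_0_INR; lia.
Qed.

Lemma node_le_inv (k : Z) (m n : nat) : node k m <= node k n -> (n <= m)%nat.
Proof.
intros H. apply Nat.nlt_ge; intros Hlt. apply (Rle_not_lt _ _ H).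
unfold node. apply Rplus_lt_compat_l, Rinv_lt_contravar; [|apply lt_INR; lia].
apply Rmult_lt_0_compat; apply lt_0_INR; lia.
Qed.

Lemma node_bounds (k : Z) (n : nat) : IZR k < node k n <= IZR (k + 1).
Proof.
unfold node. rewrite plus_IZR.
assert (H : 0 < INR (S n)) by (apply lt_0_INR; lia).
pose proof (Rinv_0_lt_compat _ H).
assert (/ INR (S n) <= 1); [|lra].
rewrite <- Rinv_1. apply Rinv_le_contravar; [lra|]. apply (le_INR 1). lia.
Qed.

Lemma node_0 (k : Z) : node k 0 = IZR (k + 1).
Proof. unfold node. change (INR 1) with 1. now rewrite plus_IZR, Rinv_1. Qed.

Lemma cell_bounds (k : Z) (n : nat) (x : R) : cell k n x -> IZR k < x <= IZR (k + 1).
Proof.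
intros (H1 & H2). pose proof (node_bounds k n). pose proof (node_bounds k (S n)). lra.
Qed.

Lemma cell_left (x : R) : exists k n, node k (S n) < x <= node k n.
Proof.
destruct (archimed (- x)) as (H1 & H2).
(* [up (- x)] lies strictly above [- x], so [k] is the largest integer strictly below [x]; an
   integer [x] becomes the right end [node k 0]. *)
set (k := (- up (- x))%Z).
assert (Hk : 0 < x - IZR k <= 1) by (unfold k; rewrite opp_IZR; lra).
assert (Hi : 1 <= / (x - IZR k)).
{ rewrite <- Rinv_1 at 1. apply Rinv_le_contravar; lra. }
(* This [n] satisfies [n + 1 <= / (x - IZR k) < n + 2], which inverts to the two node
   inequalities. *)
destruct (nfloor_ex (/ (x - IZR k) - 1)) as (n & Hn); [lra|].
exists k, n. unfold node. rewrite !S_INR. pose proof (pos_INR n).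
split; apply Rplus_lt_reg_l with (- IZR k) || apply Rplus_le_reg_l with (- IZR k).
- replace (- IZR k + x) with (/ / (x - IZR k)) by (rewrite Rinv_inv; ring).
  replace (- IZR k + (IZR k + / (INR n + 1 + 1))) with (/ (INR n + 1 + 1)) by ring.
  apply Rinv_lt_contravar; [|lra]. apply Rmult_lt_0_compat; lra.
- replace (- IZR k + x) with (/ / (x - IZR k)) by (rewrite Rinv_inv; ring).
  replace (- IZR k + (IZR k + / (INR n + 1))) with (/ (INR n + 1)) by ring.
  apply Rinv_le_contravar; lra.
Qed.

(** Integers are exceptional because the nodes accumulate at them from the right: no cell has an
    integer as its left end. *)
Lemma cell_right (x : R) :
  (exists k, x = IZR k) \/ exists k n, node k (S n) <= x < node k n.
Proof.
destruct (cell_left x) as (k & n & H1 & [H2 | H2]).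
- right; exists k, n. lra.
- destruct n as [|n].
  + left; exists (k + 1)%Z. now rewrite <- node_0.
  + right; exists k, n. pose proof (node_decr k n). lra.
Qed.

(* Between [exp k] and [exp (k+1)] the path interpolates linearly, in the variable [ln r],
   between the iterates of [join_const T (exp k)] started at the largest fixed point for
   [exp (k+1)]; these decrease to the largest fixed point for [exp k], but only componentwise,
   which is where norm-continuity from above is lost. *)
Section Path.

Variables (I : Type) (T : (I -> R) -> I -> R) (phi : R -> R) (M : R -> I -> R).

Hypothesis Tmono : monotone_op T.
Hypothesis Tcont : pointwise_continuous_op T.
Hypothesis Hphi : Kinf phi.
Hypothesis HM : forall r, 0 <= r -> largest_fixed_point (join_const T r) (M r).
Hypothesis Mphi : forall r, 0 <= r -> forall i, M r i <= phi r.

Definition vertex (k : Z) (n : nat) : I -> R :=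
  Nat.iter n (join_const T (exp (IZR k))) (M (exp (IZR (k + 1)))).

Lemma M_mono (r r' : R) : 0 <= r -> r <= r' -> vle (M r) (M r').
Proof.
intros Hr Hrr. destruct (HM r Hr) as (Hl & Hf & _).
destruct (HM r' ltac:(lra)) as (_ & _ & Hmax). apply Hmax; [easy|].
intros i. rewrite (Hf i) at 1. apply join_const_mono; auto. now intros j; right.
Qed.

Lemma M_ge (r : R) : 0 <= r -> forall i, r <= M r i.
Proof.
intros Hr i. destruct (HM r Hr) as (Hl & Hf & _). rewrite Hf. apply Rmax_l.
Qed.

(** The fixed point for the larger constant is mapped below itself by the map with the smaller one;
    hence the iterates started there decrease. *)
Lemma join_const_M (k : Z) :
  vle (join_const T (exp (IZR k)) (M (exp (IZR (k + 1))))) (M (exp (IZR (k + 1)))).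
Proof.
pose proof (exp_pos (IZR (k + 1))).
destruct (HM (exp (IZR (k + 1))) ltac:(lra)) as (Hl & Hf & _).
intros i. rewrite (Hf i). apply join_const_mono; auto.
- apply exp_le_compat, IZR_le; lia.
- now intros j; right.
Qed.

Lemma M_vertex_0 (k : Z) : vle (M (exp (IZR k))) (vertex k 0).
Proof.
apply M_mono; [apply Rlt_le, exp_pos|apply exp_le_compat, IZR_le; lia].
Qed.

Lemma vertex_spec (k : Z) (n : nat) :
  linf_pos (vertex k n) /\ vle (vertex k (S n)) (vertex k n) /\
  vle (M (exp (IZR k))) (vertex k n).
Proof.
pose proof (exp_pos (IZR k)) as Hk. pose proof (exp_pos (IZR (k + 1))) as Hk1.
induction n as [|n (H1 & H2 & H3)].
- split; [apply (HM _ (Rlt_le _ _ Hk1))|]. split; [apply join_const_M|apply M_vertex_0].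
- assert (Hl : linf_pos (vertex k (S n))).
  { apply linf_pos_le with (vertex k n); [easy|]. intros i. split; [|apply H2].
    apply Rle_trans with (exp (IZR k)); [lra|apply Rmax_l]. }
  split; [easy|]. split.
  + apply join_const_mono; auto. lra.
  + destruct (HM _ (Rlt_le _ _ Hk)) as (HMl & Hf & _). intros i. rewrite Hf.
    apply join_const_mono; auto. lra.
Qed.

Lemma vertex_antitone (k : Z) (m n : nat) : (m <= n)%nat -> vle (vertex k n) (vertex k m).
Proof.
intros H. induction H as [|n H IH]; [now intros i; right|].
intros i. apply Rle_trans with (2 := IH i). apply vertex_spec.
Qed.

Lemma vertex_cv (k : Z) (i : I) : Un_cv (fun n => vertex k n i) (M (exp (IZR k)) i).
Proof.
pose proof (exp_pos (IZR k)) as Hk. pose proof (exp_pos (IZR (k + 1))) as Hk1.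
apply iter_cv_largest_fixed_point.
- intros s j _. apply Rle_trans with (exp (IZR k)); [lra|apply Rmax_l].
- intros s t Hs Ht Hst. apply join_const_mono; auto. lra.
- now apply join_const_continuous.
- apply HM; lra.
- apply HM; lra.
- apply join_const_M.
- apply M_vertex_0.
Qed.

Definition segment (k : Z) (n : nat) (x : R) : I -> R := fun i =>
  vertex k (S n) i +
  (x - node k (S n)) / (node k n - node k (S n)) * (vertex k n i - vertex k (S n) i).

Lemma segment_left (k : Z) (n : nat) (i : I) : segment k n (node k (S n)) i = vertex k (S n) i.
Proof. unfold segment, Rdiv. ring. Qed.

Lemma segment_right (k : Z) (n : nat) (i : I) : segment k n (node k n) i = vertex k n i.
Proof. unfold segment. pose proof (node_decr k n). field. lra. Qed.

Lemma segment_mono (k : Z) (n : nat) (x y : R) :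
  x <= y -> vle (segment k n x) (segment k n y).
Proof.
intros H i. unfold segment. apply Rplus_le_compat_l, Rmult_le_compat_r.
- pose proof (proj1 (proj2 (vertex_spec k n)) i). lra.
- pose proof (node_decr k n). apply Rmult_le_compat_r; [|lra].
  apply Rlt_le, Rinv_0_lt_compat. lra.
Qed.

Lemma segment_between (k : Z) (n : nat) (x : R) : cell k n x ->
  vle (vertex k (S n)) (segment k n x) /\ vle (segment k n x) (vertex k n).
Proof.
intros (H1 & H2); split; intros i.
- rewrite <- segment_left. now apply segment_mono.
- rewrite <- segment_right. now apply segment_mono.
Qed.

Lemma segment_M_bounds (k : Z) (n : nat) (x : R) : cell k n x ->
  vle (M (exp (IZR k))) (segment k n x) /\ vle (segment k n x) (M (exp (IZR (k + 1)))).
Proof.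
intros H. destruct (segment_between k n x H) as (H1 & H2). split; intros i.
- apply Rle_trans with (2 := H1 i). apply vertex_spec.
- apply Rle_trans with (1 := H2 i). apply (vertex_antitone k 0 n). lia.
Qed.

(** A point between consecutive iterates is below [vertex k n], so its image under [T] is below
    [T (vertex k n)], hence below [vertex k (S n)], hence below the point itself. *)
Lemma segment_Psi (k : Z) (n : nat) (x : R) : cell k n x -> Psi T (segment k n x).
Proof.
intros H. destruct (segment_between k n x H) as (H1 & H2).
destruct (vertex_spec k n) as (Hl & _). destruct (vertex_spec k (S n)) as (Hl' & _).
assert (Hs : linf_pos (segment k n x)).
{ apply linf_pos_le with (vertex k n); [easy|]. intros i. split; [|apply H2].
  apply Rle_trans with (2 := H1 i). apply Hl'. }
split; [easy|]. intros i. apply Rle_trans with (2 := H1 i).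
apply Rle_trans with (T (vertex k n) i); [now apply Tmono|]. apply Rmax_r.
Qed.

(** Serves twice: it makes the path increasing, and, used in both directions with [x = y], it shows
    that cells sharing an end point agree there, so that the segments can be glued. *)
Lemma segment_le (k k' : Z) (n n' : nat) (x y : R) :
  cell k n x -> cell k' n' y -> x <= y -> vle (segment k n x) (segment k' n' y).
Proof.
intros Hx Hy Hxy i.
pose proof (cell_bounds _ _ _ Hx) as Bx; pose proof (cell_bounds _ _ _ Hy) as By.
assert (Hk : (k <= k')%Z).
{ assert (k < k' + 1)%Z by (apply lt_IZR; lra). lia. }
destruct (Z.eq_dec k k') as [<- | Hne].
(* Nodes decrease in their index, so the cell of the larger point [y] has index at most [n + 1];
   index [n + 1] is possible only when [x = y] is the common end point. *)
- assert (Hn : (n' <= S n)%nat).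
  { apply (node_le_inv k). destruct Hx, Hy. lra. }
  destruct (Nat.eq_dec n' (S n)) as [-> | Hn1]; [|destruct (Nat.eq_dec n' n) as [-> | Hn2]].
  + assert (x = node k (S n)) as -> by (destruct Hx, Hy; lra).
    assert (y = node k (S n)) as -> by (destruct Hx, Hy; lra).
    rewrite segment_left, segment_right. lra.
  + now apply segment_mono.
  + apply Rle_trans with (vertex k n i); [now apply segment_between|].
    apply Rle_trans with (vertex k (S n') i); [|now apply segment_between].
    apply vertex_antitone. lia.
- apply Rle_trans with (M (exp (IZR (k + 1))) i); [now apply (segment_M_bounds k n)|].
  apply Rle_trans with (M (exp (IZR k')) i); [|now apply (segment_M_bounds k' n')].
  apply M_mono; [apply Rlt_le, exp_pos|]. apply exp_le_compat, IZR_le. lia.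
Qed.

Lemma glued_segments :
  exists tau : R -> I -> R, forall x k n, cell k n x -> forall i, tau x i = segment k n x i.
Proof.
apply (choice (fun x t => forall k n, cell k n x -> forall i, t i = segment k n x i)).
intros x. destruct (cell_left x) as (k & n & H1 & H2).
assert (H : cell k n x) by (split; lra).
exists (segment k n x). intros k' n' H' i.
apply Rle_antisym; apply segment_le; auto; lra.
Qed.

(** The factors [exp 1] come from the grid: for [e^k < r <= e^(k+1)] the path lies between [M (e^k)]
    and [M (e^(k+1))]. The last two clauses are one-point forms of (C1) and (C2), sufficient by
    monotonicity; [r'] is uniform in the entries in the first of them, and depends on [i] in the
    second. *)
Lemma path_exists : exists sigma : R -> I -> R,
  (forall r, 0 <= r -> Psi T (sigma r)) /\
  (forall r, 0 <= r -> forall i, / exp 1 * r <= sigma r i <= phi (exp 1 * r)) /\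
  (forall r r', 0 <= r -> r <= r' -> vle (sigma r) (sigma r')) /\
  (forall r, 0 < r -> forall eps, 0 < eps ->
     exists r', 0 < r' < r /\ forall i, sigma r i - eps <= sigma r' i) /\
  (forall r, 0 <= r -> forall i eps, 0 < eps ->
     exists r', r < r' /\ sigma r' i <= sigma r i + eps).
Proof.
destruct glued_segments as (tau & Htau).
(* The logarithmic scale does not reach 0; the value there is [M 0], the zero vector since
   [0 <= M 0 <= phi 0]. *)
set (sigma := fun r => if Rlt_dec 0 r then tau (ln r) else M 0).
assert (Hpos : forall r, 0 < r -> sigma r = tau (ln r)).
{ intros r Hr. unfold sigma. destruct (Rlt_dec 0 r); [easy|contradiction]. }
assert (Hexp : forall x, sigma (exp x) = tau x).
{ intros x. rewrite Hpos by apply exp_pos. now rewrite ln_exp. }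
assert (H0 : sigma 0 = M 0).
{ unfold sigma. destruct (Rlt_dec 0 0); [lra|easy]. }
assert (Hphi0 : phi 0 = 0) by apply Hphi.
assert (HM0 : forall i, M 0 i = 0).
{ intros i. pose proof (M_ge 0 ltac:(lra) i). pose proof (Mphi 0 ltac:(lra) i). lra. }
assert (Hcase : forall r, 0 <= r -> r = 0 \/ exists k n x, cell k n x /\ r = exp x).
{ intros r [Hr | <-]; [right|now left]. destruct (cell_left (ln r)) as (k & n & H1 & H2).
  exists k, n, (ln r). split; [split; lra|]. now rewrite exp_ln. }
assert (Hbd : forall r, 0 <= r -> forall i, / exp 1 * r <= sigma r i <= phi (exp 1 * r)).
{ intros r Hr i. destruct (Hcase r Hr) as [-> | (k & n & x & Hc & ->)].
  - rewrite H0, HM0, !Rmult_0_r, Hphi0. lra.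
  - rewrite Hexp, (Htau x k n Hc). destruct (segment_M_bounds k n x Hc) as (H1 & H2).
    pose proof (cell_bounds k n x Hc) as Bx. rewrite plus_IZR in Bx.
    pose proof (exp_pos (IZR k)) as Hk. pose proof (exp_pos (IZR (k + 1))) as Hk1. split.
    + apply Rle_trans with (2 := H1 i). apply Rle_trans with (2 := M_ge _ (Rlt_le _ _ Hk) i).
      rewrite <- exp_Ropp, <- exp_plus. apply exp_le_compat. lra.
    + apply Rle_trans with (1 := H2 i).
      apply Rle_trans with (1 := Mphi _ (Rlt_le _ _ Hk1) i).
      apply Kinf_le; [easy|lra|]. rewrite <- exp_plus, plus_IZR. apply exp_le_compat. lra. }
exists sigma. split; [|split; [easy|split; [|split]]].
- intros r Hr. destruct (Hcase r Hr) as [-> | (k & n & x & Hc & ->)].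
  + rewrite H0. destruct (HM 0 ltac:(lra)) as (Hl & Hf & _). split; [easy|].
    intros i. rewrite (Hf i). apply Rmax_r.
  + rewrite Hexp. destruct (segment_Psi k n x Hc) as (Hl & HP).
    assert (Hl' : linf_pos (tau x)).
    { apply linf_pos_le with (segment k n x); [easy|]. intros i. rewrite (Htau x k n Hc).
      split; [apply Hl|lra]. }
    split; [easy|]. intros i. rewrite (Htau x k n Hc). apply Rle_trans with (2 := HP i).
    apply Tmono; auto. intros j. rewrite (Htau x k n Hc). lra.
- intros r r' Hr Hrr' i.
  destruct (Hcase r Hr) as [-> | (k & n & x & Hc & ->)].
  + rewrite H0, HM0. pose proof (Hbd r' Hrr' i).
    pose proof (exp_pos 1) as He. apply Rinv_0_lt_compat in He. nra.
  + destruct (Hcase r' ltac:(lra)) as [-> | (k' & n' & x' & Hc' & ->)].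
    { pose proof (exp_pos x). lra. }
    rewrite !Hexp, (Htau x k n Hc), (Htau x' k' n' Hc'). apply segment_le; auto.
    apply Rnot_lt_le; intros Hlt. apply exp_increasing in Hlt. lra.
- intros r Hr eps He. rewrite (Hpos r Hr). set (x := ln r).
  destruct (cell_left x) as (k & n & Hx1 & Hx2).
  set (w := node k n - node k (S n)).
  assert (Hw : 0 < w) by (unfold w; pose proof (node_decr k n); lra).
  set (B := phi (exp (IZR (k + 1)))).
  pose proof (exp_pos (IZR (k + 1))) as Hk1.
  assert (HB : 0 < B) by now apply Kinf_gt0.
  (* Over the cell of width [w] every entry rises by at most [B], so stepping back by
     [w * (eps / B)] loses at most [eps] in all entries at once. [Rmax] keeps [y] in the cell. *)
  set (y := Rmax (node k (S n)) (x - w * (eps / B))).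
  assert (Hy1 : node k (S n) <= y) by apply Rmax_l.
  assert (Hy2 : x - w * (eps / B) <= y) by apply Rmax_r.
  assert (Hyx : y < x).
  { apply Rmax_lub_lt; [easy|].
    assert (0 < w * (eps / B)); [|lra].
    apply Rmult_lt_0_compat; [easy|now apply Rdiv_lt_0_compat]. }
  exists (exp y). split.
  + split; [apply exp_pos|]. rewrite <- (exp_ln r) by easy. now apply exp_increasing.
  + intros i. rewrite Hexp, (Htau x k n ltac:(split; lra)), (Htau y k n ltac:(split; lra)).
    assert (Hd : segment k n x i - segment k n y i
                 = (x - y) / w * (vertex k n i - vertex k (S n) i)).
    { unfold segment. fold w. field. lra. }
    assert (Hv : 0 <= vertex k n i - vertex k (S n) i <= B).
    { destruct (vertex_spec k (S n)) as ((Hp & _) & _). specialize (Hp i).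
      destruct (vertex_spec k n) as (_ & Hdec & _). specialize (Hdec i).
      pose proof (vertex_antitone k 0 n ltac:(lia) i) as H.
      pose proof (Mphi _ (Rlt_le _ _ Hk1) i). change (vertex k 0) with (M (exp (IZR (k + 1)))) in H.
      fold B in H1. lra. }
    assert (Hxy : 0 <= (x - y) / w <= eps / B).
    { split; [apply Rdiv_le_0_compat; lra|]. apply (Rmult_le_reg_l w); [easy|].
      replace (w * ((x - y) / w)) with (x - y) by (field; lra). lra. }
    assert ((x - y) / w * (vertex k n i - vertex k (S n) i) <= eps / B * B)
      by (apply Rmult_le_compat; lra).
    replace (eps / B * B) with eps in H by (field; lra). lra.
- intros r Hr i eps He. destruct Hr as [Hr | <-].
  + rewrite (Hpos r Hr). set (x := ln r).
    destruct (cell_right x) as [(k & Hk) | (k & n & Hx1 & Hx2)].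
    (* At [x = k] the path has value [M (e^k)], the right end of the first cell of the interval
       below, and the iterates from the interval above converge to it entrywise: a node [node k n]
       with [n] chosen for this [i] suffices. *)
    * destruct (vertex_cv k i eps He) as (n & Hn). specialize (Hn n (Nat.le_refl _)).
      apply Rabs_def2 in Hn.
      pose proof (node_decr k n) as Hdec. pose proof (node_decr (k - 1) 0) as Hdec'.
      exists (exp (node k n)). split.
      { rewrite <- (exp_ln r) by easy. apply exp_increasing. fold x. rewrite Hk.
        apply node_bounds. }
      assert (Hx : x = node (k - 1) 0).
      { rewrite node_0, Hk. f_equal. lia. }
      rewrite Hexp, Hx, (Htau _ k n) by (split; lra).
      rewrite (Htau _ (k - 1)%Z 0%nat) by (split; lra).
      rewrite !segment_right. unfold vertex at 2. simpl Nat.iter.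
      replace (k - 1 + 1)%Z with k by lia. lra.
    * set (w := node k n - node k (S n)).
      assert (Hw : 0 < w) by (unfold w; lra).
      set (D := vertex k n i - vertex k (S n) i).
      assert (HD : 0 <= D).
      { destruct (vertex_spec k n) as (_ & Hdec & _). specialize (Hdec i). unfold D; lra. }
      (* The rise [D] of entry [i] over the cell may be 0; dividing by [D + 1] avoids a case
         distinction. *)
      set (y := Rmin (node k n) (x + w * (eps / (D + 1)))).
      assert (Hy1 : y <= node k n) by apply Rmin_l.
      assert (Hy2 : y <= x + w * (eps / (D + 1))) by apply Rmin_r.
      assert (He' : 0 < eps / (D + 1)) by (apply Rdiv_lt_0_compat; lra).
      assert (Hyx : x < y).
      { apply Rmin_glb_lt; [easy|]. pose proof (Rmult_lt_0_compat _ _ Hw He'). lra. }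
      exists (exp y). split.
      { rewrite <- (exp_ln r) by easy. now apply exp_increasing. }
      rewrite Hexp, (Htau x k n ltac:(split; lra)), (Htau y k n ltac:(split; lra)).
      assert (Hd : segment k n y i - segment k n x i = (y - x) / w * D).
      { unfold segment, D. fold w. field. lra. }
      assert (Hxy : 0 <= (y - x) / w <= eps / (D + 1)).
      { split; [apply Rdiv_le_0_compat; lra|]. apply (Rmult_le_reg_l w); [easy|].
        replace (w * ((y - x) / w)) with (y - x) by (field; lra). lra. }
      assert ((y - x) / w * D <= eps / (D + 1) * (D + 1))
        by (apply Rmult_le_compat; lra).
      replace (eps / (D + 1) * (D + 1)) with eps in H by (field; lra). lra.
  + rewrite H0, HM0.
    (* At 0 the upper bound [phi (exp 1 * r')] already controls the path; [r'] is chosen to make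
       this bound equal to [eps]. *)
    destruct (Kinf_surj phi eps Hphi ltac:(lra)) as (y & Hy & Hey).
    assert (Hy0 : 0 < y).
    { apply (Kinf_lt_inv phi); [easy..|]. lra. }
    pose proof (exp_pos 1) as He1. exists (/ exp 1 * y). split.
    { apply Rmult_lt_0_compat; [now apply Rinv_0_lt_compat|easy]. }
    pose proof (Rmult_lt_0_compat _ _ (Rinv_0_lt_compat _ He1) Hy0) as Hp.
    pose proof (proj2 (Hbd _ (Rlt_le _ _ Hp) i)) as H.
    replace (exp 1 * (/ exp 1 * y)) with y in H by (field; lra). lra.
Qed.

End Path.

(** By monotonicity one [r'] that is uniformly good for [r0] is good for every parameter between
    [r'] and [r0], hence for the tail of the sequence. *)
Lemma continuous_from_below (I : Type) (sigma : R -> I -> R) :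
  inhabited I ->
  (forall r, 0 <= r -> linf_pos (sigma r)) ->
  (forall r r', 0 <= r -> r <= r' -> vle (sigma r) (sigma r')) ->
  (forall r, 0 < r -> forall eps, 0 < eps ->
     exists r', 0 < r' < r /\ forall i, sigma r i - eps <= sigma r' i) ->
  forall (rn : nat -> R) r0, 0 <= r0 -> (forall n, 0 <= rn n <= r0) -> Un_cv rn r0 ->
    Un_cv (fun n => supnorm (vsub (sigma (rn n)) (sigma r0))) 0.
Proof.
intros HI Hl Hmono Hleft rn r0 Hr0 Hrn Hcv eps He.
assert (Hr1 : exists d, 0 < d /\
  forall r, 0 <= r <= r0 -> r0 - d < r -> forall i, sigma r0 i - eps / 2 <= sigma r i).
{ destruct Hr0 as [Hr0 | <-].
  - destruct (Hleft r0 Hr0 (eps / 2) ltac:(lra)) as (r1 & Hr1 & H).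
    exists (r0 - r1). split; [lra|]. intros r Hr Hrd i.
    apply Rle_trans with (1 := H i). apply Hmono; lra.
  - exists 1. split; [lra|]. intros r Hr _ i. replace r with 0 by lra. lra. }
destruct Hr1 as (d & Hd & H). destruct (Hcv d Hd) as (N & HN).
exists N. intros n Hn. specialize (HN n Hn). apply Rabs_def2 in HN.
assert (Hi : forall i, Rabs (vsub (sigma (rn n)) (sigma r0) i) <= eps / 2).
{ intros i. unfold vsub. specialize (Hrn n).
  pose proof (H (rn n) Hrn ltac:(lra) i).
  pose proof (Hmono (rn n) r0 (proj1 Hrn) (proj2 Hrn) i). apply Rabs_le. lra. }
unfold R_dist. rewrite Rminus_0_r, Rabs_pos_eq.
- pose proof (supnorm_le I _ _ HI Hi). lra.
- apply supnorm_ge0; [easy|]. now exists (eps / 2).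
Qed.

Lemma weakstar_continuous_from_above (I : Type) (sigma : R -> I -> R) :
  inhabited I ->
  (forall r, 0 <= r -> linf_pos (sigma r)) ->
  (forall r r', 0 <= r -> r <= r' -> vle (sigma r) (sigma r')) ->
  (forall r, 0 <= r -> forall i eps, 0 < eps ->
     exists r', r < r' /\ sigma r' i <= sigma r i + eps) ->
  forall (rn : nat -> R) r0, 0 <= r0 -> (forall n, r0 <= rn n) -> Un_cv rn r0 ->
    weakstar_cv (fun n => sigma (rn n)) (sigma r0).
Proof.
intros HI Hl Hmono Hright rn r0 Hr0 Hrn Hcv. split.
(* A convergent sequence of parameters has a bound [B], and by monotonicity the single vector
   [sigma B] dominates all values: this is the norm bound in weak* convergence. *)
- destruct (maj_by_pos rn (exist _ r0 Hcv)) as (B & HB & HrB).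
  destruct (Hl B ltac:(lra)) as (_ & C & HC).
  exists C. intros n. apply supnorm_le; [easy|]. intros i.
  specialize (Hrn n). rewrite Rabs_pos_eq by (apply Hl; lra).
  apply Rle_trans with (sigma B i).
  + apply Hmono; [lra|]. apply Rle_trans with (2 := HrB n). apply Rle_abs.
  + apply Rle_trans with (2 := HC i). apply Rle_abs.
- intros i eps He. destruct (Hright r0 Hr0 i (eps / 2) ltac:(lra)) as (r1 & Hr1 & H).
  destruct (Hcv (r1 - r0) ltac:(lra)) as (N & HN). exists N. intros n Hn.
  specialize (HN n Hn). apply Rabs_def2 in HN. specialize (Hrn n).
  pose proof (Hmono r0 (rn n) Hr0 Hrn i). pose proof (Hmono (rn n) r1 ltac:(lra) ltac:(lra) i).
  apply Rabs_def1; lra.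
Qed.

(** * The gain operator *)

Section GainOperator.

Variables (I : Type) (Iset : I -> list I) (gam : I -> I -> R -> R) (mu : I -> (I -> R) -> Rbar).

Hypothesis HI : inhabited I.
Hypothesis Hgam : forall i j, In j (Iset i) -> Kinf (gam i j).
Hypothesis mu_ge0 : forall i s, linf_pos s -> Rbar_le (Finite 0) (mu i s).
Hypothesis mu_mono : forall i s t, linf_pos s -> linf_pos t -> vle s t -> Rbar_le (mu i s) (mu i t).
Hypothesis mu_finite : forall i (J : list I),
     (forall s, linf_pos s -> supported_in J s -> is_finite (mu i s)) /\
     (forall s, linf_pos s -> supported_in J s -> forall eps, 0 < eps ->
        exists delta, 0 < delta /\ forall t, linf_pos t -> supported_in J t ->
          supnorm (vsub t s) < delta -> Rabs (real (mu i t) - real (mu i s)) < eps).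

Definition gain_arg (i : I) (s : I -> R) : I -> R :=
  fun j => if excluded_middle_informative (In j (Iset i)) then gam i j (s j) else 0.

Lemma gain_arg_supported (i : I) (s : I -> R) : supported_in (Iset i) (gain_arg i s).
Proof.
intros j Hj. unfold gain_arg. destruct excluded_middle_informative; [contradiction|easy].
Qed.

Lemma finite_upper_bound (J : list I) (f : I -> R) :
  exists B, 0 <= B /\ forall j, In j J -> f j <= B.
Proof.
induction J as [|a J (B & HB0 & HB)].
- exists 0. split; [lra|]. now intros.
- exists (Rmax (f a) B). split; [apply Rle_trans with (1 := HB0), Rmax_r|].
  intros j [<- | Hj]; [apply Rmax_l|].
  apply Rle_trans with (1 := HB j Hj), Rmax_r.
Qed.

Lemma gain_arg_linf_pos (i : I) (s : I -> R) : linf_pos s -> linf_pos (gain_arg i s).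
Proof.
intros (Hs & _). destruct (finite_upper_bound (Iset i) (fun j => gam i j (s j))) as (B & HB0 & HB).
apply linf_pos_between with B. intros j. unfold gain_arg.
destruct excluded_middle_informative as [Hj | Hj]; [|lra].
split; [apply Kinf_ge0; auto|now apply HB].
Qed.

(** [Gamma] applies [real], which would turn an infinite gain into 0. By (M3) the value is finite on
    vectors supported in the finite set [Iset i], so inequalities in [Rbar] transfer to [Gamma]. *)
Lemma mu_gain_arg_finite (i : I) (s : I -> R) :
  linf_pos s -> Finite (Gamma Iset gam mu s i) = mu i (gain_arg i s).
Proof.
intros Hs. apply (proj1 (mu_finite i (Iset i))).
- now apply gain_arg_linf_pos.
- apply gain_arg_supported.
Qed.

Lemma Gamma_nonneg : nonneg_op (Gamma Iset gam mu).
Proof.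
intros s i Hs. change (Rbar_le 0 (Gamma Iset gam mu s i)).
rewrite mu_gain_arg_finite by easy. apply mu_ge0. now apply gain_arg_linf_pos.
Qed.

Lemma Gamma_mono : monotone_op (Gamma Iset gam mu).
Proof.
intros s t Hs Ht Hst i. change (Rbar_le (Gamma Iset gam mu s i) (Gamma Iset gam mu t i)).
rewrite !mu_gain_arg_finite by easy. apply mu_mono; try now apply gain_arg_linf_pos.
intros j. unfold gain_arg. destruct excluded_middle_informative as [Hj | Hj]; [|lra].
apply Kinf_le; [auto|apply Hs|apply Hst].
Qed.

Lemma gain_arg_continuous (i : I) (s : I -> R) (eps : R) : linf_pos s -> 0 < eps ->
  exists delta, 0 < delta /\ forall t, linf_pos t ->
    (forall j, In j (Iset i) -> Rabs (t j - s j) < delta) ->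
    forall j, In j (Iset i) -> Rabs (gam i j (t j) - gam i j (s j)) < eps.
Proof.
intros Hs He. pose proof (Hgam i) as HK. induction (Iset i) as [|a J IH].
- exists 1. split; [lra|]. now intros.
- destruct IH as (d & Hd & HJ); [intros j Hj; apply HK; now right|].
  destruct (HK a (or_introl eq_refl)) as (_ & Hc & _).
  destruct (Hc (s a) (proj1 Hs a) eps He) as (d' & Hd' & Ha).
  exists (Rmin d d'). split; [now apply Rmin_glb_lt|]. intros t Ht Hts.
  pose proof (Rmin_l d d'); pose proof (Rmin_r d d').
  intros j [<- | Hj].
  + apply Ha; [apply Ht|]. specialize (Hts a (or_introl eq_refl)). lra.
  + apply HJ; auto. intros j' Hj'. specialize (Hts j' (or_intror Hj')). lra.
Qed.

(** Both arguments of [mu i] vanish off [Iset i], so closeness on this finite set is already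
    closeness in norm, to which (M3) applies. *)
Lemma Gamma_continuous : pointwise_continuous_op (Gamma Iset gam mu).
Proof.
intros i s Hs eps He.
destruct (proj2 (mu_finite i (Iset i)) (gain_arg i s) (gain_arg_linf_pos i s Hs)
            (gain_arg_supported i s) eps He) as (d & Hd & H).
destruct (gain_arg_continuous i s (d / 2) Hs ltac:(lra)) as (d' & Hd' & H').
exists d', (Iset i). split; [easy|]. intros t Ht Hts. specialize (H' t Ht Hts).
apply H; [now apply gain_arg_linf_pos|apply gain_arg_supported|].
apply Rle_lt_trans with (d / 2); [|lra]. apply supnorm_le; [easy|]. intros j.
unfold vsub, gain_arg. destruct excluded_middle_informative as [Hj | Hj].
- now apply Rlt_le, H'.
- rewrite Rminus_0_r, Rabs_R0. lra.
Qed.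

End GainOperator.

Lemma Gamma_rho_nonneg (I : Type) (rho : R -> R) (T : (I -> R) -> I -> R) :
  Kinf rho -> nonneg_op T -> nonneg_op (Gamma_rho rho T).
Proof.
intros Hr HT s i Hs. unfold Gamma_rho. pose proof (HT s i Hs) as H.
pose proof (Kinf_ge0 rho _ Hr H). lra.
Qed.

Lemma Gamma_rho_mono (I : Type) (rho : R -> R) (T : (I -> R) -> I -> R) :
  Kinf rho -> nonneg_op T -> monotone_op T -> monotone_op (Gamma_rho rho T).
Proof.
intros Hr HT HT' s t Hs Ht Hst i. unfold Gamma_rho.
pose proof (HT s i Hs) as H. pose proof (HT' s t Hs Ht Hst i) as H'.
pose proof (Kinf_le rho _ _ Hr H H'). lra.
Qed.

Lemma Gamma_rho_continuous (I : Type) (rho : R -> R) (T : (I -> R) -> I -> R) :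
  Kinf rho -> nonneg_op T -> pointwise_continuous_op T ->
  pointwise_continuous_op (Gamma_rho rho T).
Proof.
intros (_ & Hc & _) HT HT' i s Hs eps He. unfold Gamma_rho.
destruct (Hc (T s i) (HT s i Hs) (eps / 2) ltac:(lra)) as (d & Hd & H).
destruct (HT' i s Hs (Rmin d (eps / 2))) as (d' & J & Hd' & H'); [apply Rmin_glb_lt; lra|].
exists d', J. split; [easy|]. intros t Ht Hts. specialize (H' t Ht Hts).
pose proof (Rmin_l d (eps / 2)); pose proof (Rmin_r d (eps / 2)).
pose proof (H (T t i) (HT t i Ht) ltac:(lra)) as Hr.
apply Rabs_def2 in Hr. assert (H2 : Rabs (T t i - T s i) < eps / 2) by lra.
apply Rabs_def2 in H2. apply Rabs_def1; lra.
Qed.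

Theorem theorem3p26 (I : Type)
  (I_countable : exists f : I -> nat, forall x y, f x = f y -> x = y)
  (I_nonempty : inhabited I)
  (Iset : I -> list I) (gam : I -> I -> R -> R) (mu : I -> (I -> R) -> Rbar)
  (Hgain : gain_operator_data Iset gam mu) :
  (exists rho, Kinf rho /\ oplus_MBI (Gamma_rho rho (Gamma Iset gam mu)))
  <->
  (exists rho (sigma : R -> I -> R), Kinf rho /\
     (forall r, 0 <= r -> Psi (Gamma_rho rho (Gamma Iset gam mu)) (sigma r)) /\
     (exists phimin phimax, Kinf phimin /\ Kinf phimax /\
        forall r, 0 <= r -> forall i, phimin r <= sigma r i <= phimax r) /\
     (forall r1 r2, 0 <= r1 -> r1 <= r2 -> vle (sigma r1) (sigma r2)) /\
     (* (C1) norm-continuity from below *)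
     (forall (rn : nat -> R) r0, 0 <= r0 -> (forall n, 0 <= rn n <= r0) -> Un_cv rn r0 ->
        Un_cv (fun n => supnorm (vsub (sigma (rn n)) (sigma r0))) 0) /\
     (* (C2) sequential weak* continuity from above *)
     (forall (rn : nat -> R) r0, 0 <= r0 -> (forall n, r0 <= rn n) -> Un_cv rn r0 ->
        weakstar_cv (fun n => sigma (rn n)) (sigma r0))).
Proof.
destruct Hgain as (_ & Hgam & _ & _ & mu0 & mumono & mufin & _).
pose proof (Gamma_nonneg I Iset gam mu Hgam mu0 mufin) as Gpos.
pose proof (Gamma_mono I Iset gam mu Hgam mumono mufin) as Gmono.
pose proof (Gamma_continuous I Iset gam mu I_nonempty Hgam mufin) as Gcont.
split.
- intros (rho & Hrho & phi & Hphi & HMBI).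
  pose proof (Gamma_rho_nonneg I rho _ Hrho Gpos) as Tpos.
  pose proof (Gamma_rho_mono I rho _ Hrho Gpos Gmono) as Tmono.
  pose proof (Gamma_rho_continuous I rho _ Hrho Gpos Gcont) as Tcont.
  set (T := Gamma_rho rho (Gamma Iset gam mu)) in *.
  assert (HM : forall r, exists m, 0 <= r -> largest_fixed_point (join_const T r) m).
  { intros r. destruct (Rle_dec 0 r) as [Hr | Hr].
    - destruct (largest_fixed_point_exists I T phi r) as (m & Hm); auto. now exists m.
    - exists (fun _ => 0). intros; contradiction. }
  destruct (choice _ HM) as (M & HM').
  destruct (path_exists I T phi M) as (sigma & HP & Hbd & Hmono & Hleft & Hright); auto.
  { intros r Hr i. destruct (HM' r Hr) as (Hl & Hf & _).
    apply (sub_fixed_point_bound I T phi r (M r) i); auto.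
    intros j. now right. }
  assert (Hl : forall r, 0 <= r -> linf_pos (sigma r)) by (intros r Hr; apply HP, Hr).
  pose proof (exp_pos 1) as He.
  exists rho, sigma. split; [easy|]. split; [easy|]. split; [|split; [easy|split]].
  + exists (fun r => / exp 1 * r), (fun r => phi (exp 1 * r)). split; [|split; [|easy]].
    * now apply Kinf_scal, Rinv_0_lt_compat.
    * apply Kinf_comp; [easy|now apply Kinf_scal].
  + now apply continuous_from_below.
  + now apply weakstar_continuous_from_above.
- intros (rho & sigma & Hrho & HPsi & (phimin & phimax & Hmin & Hmax & Hbd) & _ & C1 & C2).
  exists (fun x => / 2 * rho x). split.
  + apply (Kinf_comp (fun x => / 2 * x) rho); [apply Kinf_scal; lra|easy].
  + now apply (path_MBI I (Gamma Iset gam mu) rho sigma phimin phimax).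
Qed.
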